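(* Let $\mathcal{R}$ be a $\ast$-ring with identity and let $a\in\mathcal{R}^{\dagger}$. For $z\in\mathcal{R}$ the following statements are equivalent: (i) $z\in a\{-\dagger\}$; (ii) $x=z$ is a solution of the system $xax=x$ and $ax=aa^{\dagger}$; (iii) $z\in a\{1,2,3\}$.
   Context: A $\ast$-ring is an associative ring with an involution $\ast$, i.e. $(x^{\ast})^{\ast}=x$, $(x+y)^{\ast}=x^{\ast}+y^{\ast}$, $(xy)^{\ast}=y^{\ast}x^{\ast}$. For $a\in\mathcal{R}$ consider the equations (1) $axa=a$, (2) $xax=x$, (3) $(ax)^{\ast}=ax$, (4) $(xa)^{\ast}=xa$. An element $x$ satisfying all four is the Moore-Penrose inverse $a^{\dagger}$ of $a$ (unique if it exists); $\mathcal{R}^{\dagger}$ is the set of all $a\in\mathcal{R}$ for which $a^{\dagger}$ exists. $a\{1\}$ is the set of $x\in\mathcal{R}$ satisfying (1); elements of $a\{1\}$ are denoted $a^{-}$. $a\{1,2,3\}$ is the set of $x\in\mathcal{R}$ satisfying (1), (2) and (3). For $a\in\mathcal{R}^{\dagger}$, the set of 1MP-inverses of $a$ is $a\{-\dagger\}=\{a^{-}aa^{\dagger}: a^{-}\in a\{1\}\}$. *)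

(* Defs.v *)
From HB Require Import structures.
From mathcomp Require Import all_boot all_algebra.
From mathcomp Require Import boolp classical_sets.

Set Implicit Arguments.
Unset Strict Implicit.
Unset Printing Implicit Defensive.

Import GRing.Theory.
Local Open Scope classical_set_scope.
Local Open Scope ring_scope.

(* The base structure is pzRingType (possibly trivial unital rings), so that   *)
(* the zero ring is not excluded.                                             *)
HB.mixin Record isStarRing R of GRing.PzRing R := {
  star : R -> R;
  starK : forall x, star (star x) = x;
  starD : forall x y, star (x + y) = star x + star y;
  starM : forall x y, star (x * y) = star y * star x
}.

#[short(type="starRingType")]
HB.structure Definition StarRing := { R of isStarRing R & GRing.PzRing R }.

Section MoorePenrose.
Variable R : starRingType.
Implicit Types a x y z : R.

Definition penrose1 a x := a * x * a = a.
Definition penrose2 a x := x * a * x = x.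
Definition penrose3 a x := star (a * x) = a * x.
Definition penrose4 a x := star (x * a) = x * a.

Definition inverses1 a : set R := [set x | penrose1 a x].

Definition inverses123 a : set R :=
  [set x | [/\ penrose1 a x, penrose2 a x & penrose3 a x]].

Definition is_mp_inverse a x :=
  [/\ penrose1 a x, penrose2 a x, penrose3 a x & penrose4 a x].

Definition mp_invertible : set R := [set a | exists x, is_mp_inverse a x].

(* Junk value 0 when a has no Moore-Penrose inverse; see mp_inverseP and      *)
(* mp_inverse_uniq for the characterization on mp_invertible.                 *)
Definition mp_inverse a : R := xget 0 [set x | is_mp_inverse a x].

Definition inverses1MP a : set R :=
  [set z | exists2 x, x \in inverses1 a & z = x * a * mp_inverse a].

Lemma mp_inverseP a : a \in mp_invertible -> is_mp_inverse a (mp_inverse a).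
Proof. by rewrite in_setE => -[x ax]; apply: (xgetI 0 ax). Qed.

Lemma mp_inverse_uniq a x y : is_mp_inverse a x -> is_mp_inverse a y -> x = y.
Proof.
rewrite /is_mp_inverse /penrose1 /penrose2 /penrose3 /penrose4.
move=> [x1 x2 x3 x4] [y1 y2 y3 y4].
have axy : a * x = a * y.
  have axE : a * x = a * y * (a * x) by rewrite mulrA y1.
  by rewrite -x3 axE starM x3 y3 mulrA x1.
have xay : x * a = y * a.
  have xaE : x * a = x * a * (y * a) by rewrite -mulrA (mulrA a) y1.
  by rewrite -x4 xaE starM x4 y4 -mulrA (mulrA a) x1.
by rewrite -x2 xay -mulrA axy mulrA y2.
Qed.

End MoorePenrose.

Arguments mp_invertible {R}.

(* Main.v *)
Require Import Defs.
From HB Require Import structures.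
From mathcomp Require Import all_boot all_algebra.
From mathcomp Require Import boolp classical_sets.

Local Open Scope classical_set_scope.
Local Open Scope ring_scope.

Lemma penrose13_mulr_uniq (R : starRingType) (a x y : R) :
  penrose1 a x -> penrose3 a x -> penrose1 a y -> penrose3 a y ->
  a * x = a * y.
Proof.
rewrite /penrose1 /penrose3 => x1 x3 y1 y3.
have axE : a * x = a * y * (a * x) by rewrite GRing.mulrA y1.
(* Applying [star] swaps the two self-adjoint factors: ax = (ay)(ax) becomes ax = (ax)(ay) = (axa)y
   = ay. *)
by rewrite -x3 axE starM x3 y3 GRing.mulrA x1.
Qed.

Theorem theorem3p3 (R : starRingType) (a : R) (ha : a \in mp_invertible) (z : R) :
  [<-> z \in inverses1MP a;
       z * a * z = z /\ a * z = a * mp_inverse a;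
       z \in inverses123 a].
Proof.
have [m1 _ m3 _] := mp_inverseP ha.
have amaE : a * mp_inverse a * a = a by [].
tfae.
- rewrite in_setE => -[x]; rewrite in_setE /inverses1 /= /penrose1 => x1 ->.
  have aE : a * (x * a * mp_inverse a) = a * mp_inverse a.
    by rewrite !GRing.mulrA x1.
  split=> //.
  by rewrite -[LHS]GRing.mulrA aE GRing.mulrA -(GRing.mulrA (x * a))
             -(GRing.mulrA x) (GRing.mulrA a) amaE.
- move=> [z2 az]; rewrite in_setE; split=> //.
  + by rewrite /penrose1 az.
  + by rewrite /penrose3 az.
(* [z] serves as its own inner inverse: z = z(az) = z(a [mp_inverse a]). *)
- rewrite in_setE => -[z1 z2 z3]; rewrite in_setE; exists z; first by rewrite in_setE.
  by rewrite -GRing.mulrA -(penrose13_mulr_uniq _ _ _ _ z1 z3 m1 m3) GRing.mulrA z2.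
Qed.
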